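(* For every $n\ge 1$, $s_n^{n-1}(213,132)=0$, $s_n^n(213,132)=1$, $$s_{2n}^0(213,132)=\frac{5\cdot 4^{n-1}-2}{3},\qquad s_{2n+1}^0(213,132)=\frac{2(4^n-1)}{3},$$ and, for all $1\le k\le n-1$, $$s_{2n}^{2k}(213,132)=4^{n-k-1},\qquad s_{2n+1}^{2k}(213,132)=0,$$ $$s_{2n}^{2k+1}(213,132)=0,\qquad s_{2n+1}^{2k+1}(213,132)=4^{n-k-1}.$$
   Context: $S_n$ denotes the set of permutations of $\{1,\dots,n\}$ written in one-line notation $\pi=\pi_1\pi_2\cdots\pi_n$. For $\alpha\in S_m$, $\pi\in S_n$ contains the pattern $\alpha$ if there are indices $i_1<i_2<\dots<i_m$ such that $\pi_{i_1}\pi_{i_2}\cdots\pi_{i_m}$ is order-isomorphic to $\alpha$; otherwise $\pi$ avoids $\alpha$. For a set $T$ of patterns, $S_n^k(T)$ is the set of $\pi\in S_n$ that have exactly $k$ fixed points (indices $i$ with $\pi_i=i$) and avoid every pattern in $T$; $s_n^k(T)=|S_n^k(T)|$. The braces around $T$ are omitted, e.g. $s_n^k(213,132)=s_n^k(\{213,132\})$. *)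

(* Defs.v *)
From mathcomp Require Import all_boot all_order all_fingroup all_algebra.

Set Implicit Arguments.
Unset Strict Implicit.
Unset Printing Implicit Defensive.

(* Permutations of {1, ..., n} are elements of 'S_n, i.e. permutations of
   'I_n = {0, ..., n - 1}; shifting both positions and values by one changes
   neither the fixed points nor the pattern containment relation.             *)

Definition one_line (n : nat) (p : 'S_n) : seq nat :=
  [seq (val (p i)).+1 | i <- enum 'I_n].

(* f i is the position of p at which the i-th letter of the pattern occurs. *)
Definition occurrence (m n : nat) (a : 'S_m) (p : 'S_n)
    (f : {ffun 'I_m -> 'I_n}) : bool :=
  [forall i : 'I_m, forall j : 'I_m, (i < j) ==> (f i < f j)] &&
  [forall i : 'I_m, forall j : 'I_m, (p (f i) < p (f j)) == (a i < a j)].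

Definition contains (m n : nat) (a : 'S_m) (p : 'S_n) : bool :=
  [exists f : {ffun 'I_m -> 'I_n}, occurrence a p f].

(* Patterns of arbitrary, possibly different, lengths. *)
Definition pattern : Type := {m : nat & 'S_m}.

Definition mk_pattern (m : nat) (a : 'S_m) : pattern := existT _ m a.

Definition avoids (n : nat) (p : 'S_n) (T : seq pattern) : bool :=
  all (fun t : pattern => ~~ contains (projT2 t) p) T.

Definition nb_fixed (n : nat) (p : 'S_n) : nat := #|[set i | p i == i]|.

Definition S_avoid (n k : nat) (T : seq pattern) : {set 'S_n} :=
  [set p : 'S_n | (nb_fixed p == k) && avoids p T].

Definition s_avoid (n k : nat) (T : seq pattern) : nat := #|S_avoid n k T|.

Definition p213 : 'S_3 := tperm (inord 0) (inord 1).
Definition p132 : 'S_3 := tperm (inord 1) (inord 2).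

Lemma one_line_p213 : one_line p213 = [:: 2; 1; 3].
Proof.
rewrite /one_line /p213 !enum_ordSl (size0nil (size_enum_ord 0)) /=.
by rewrite !permE /= -!val_eqE /= !inordK.
Qed.

Lemma one_line_p132 : one_line p132 = [:: 1; 3; 2].
Proof.
rewrite /one_line /p132 !enum_ordSl (size0nil (size_enum_ord 0)) /=.
by rewrite !permE /= -!val_eqE /= !inordK.
Qed.

Definition T_213_132 : seq pattern := [:: mk_pattern p213; mk_pattern p132].

(* Main.v *)
Require Import Defs.
From mathcomp Require Import all_boot all_order all_fingroup all_algebra.
From mathcomp Require Import zify lra.

Import GRing.Theory.

Set Implicit Arguments.
Unset Strict Implicit.
Unset Printing Implicit Defensive.

(** A permutation avoiding 213 and 132 cuts [0, n) into consecutive blocks of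
    positions on which it increases; every later block lies entirely below
    every earlier one. Such a permutation is a composition of n, or
    equivalently an arbitrary set of descents among the m = n - 1 possible
    ones. The reason is [avoider_ltP]: for i < j, p i < p j holds exactly when
    there is no descent between i and j. So the descent set determines the
    relative order of all values, hence p ([descents_inj]), and conversely each
    set A of descents is realised by standardizing the keys
    i + n * #{d in A | i <= d} ([descents_surj]). There are 2 ^ m avoiders.

    On a block [s, e) the value at i is the number of smaller values, that is
    the n - e positions after the block plus the i - s earlier positions in the
    block ([value_in_block]). Hence i is fixed iff s + e = n: one central block
    carries all the fixed points and consists of them. So p has k > 0 fixed
    points iff [s, s + k) with 2 s + k = n is a block ([nb_fixedP]). This forces
    n - k to be even. If s = 0 there is no descent at all; otherwise s - 1 and
    s + k - 1 are descents, no position in between is one, and the 2 (s - 1)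
    remaining choices are free: 4 ^ (s - 1) avoiders ([s_avoid_fixed]). The
    derangements are what remains of the 2 ^ m avoiders, and their number
    follows by summing a geometric progression. *)

(** * Cardinals of intervals and of families of sets *)

Lemma card_ord_interval n a b : b <= n ->
  #|[set j : 'I_n | a <= j < b]| = b - a.
Proof.
move=> leb.
suff: #|[set j : 'I_n | a <= j < b]| = minn b n - a by rewrite (minn_idPl leb).
rewrite -sum1_card big_mkcond /=.
rewrite (eq_bigr (fun j : 'I_n => nat_of_bool (a <= j < b))); last first.
  by move=> j _; rewrite inE; case: ifP.
elim: n {leb} => [|n IHn]; first by rewrite big_ord0; lia.
by rewrite big_ord_recr /= IHn; lia.
Qed.

Lemma card_sets_with_trace (T : finType) (C F : {set T}) : F \subset C ->
  #|[set A : {set T} | A :&: C == F]| = 2 ^ (#|T| - #|C|).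
Proof.
move=> sFC.
have -> : #|T| - #|C| = #|~: C| by have := cardsC C; lia.
(* B |-> B :|: F maps the subsets of ~: C onto the sets with trace F. *)
rewrite -card_powerset.
rewrite -(@card_in_imset _ _ (fun B => B :|: F) (mem (powerset (~: C)))); last first.
  move=> A B; rewrite !inE => sA sB /setP eqAB; apply/setP=> x.
  have := eqAB x; rewrite !inE.
  have [xC|xC] := boolP (x \in C).
    have h (S : {set T}) : S \subset ~: C -> x \in S = false.
      by move=> sS; apply/negP => /(subsetP sS); rewrite inE xC.
    by rewrite (h A) // (h B).
  have /negbTE -> : x \notin F by apply: contra xC => /(subsetP sFC).
  by rewrite !orbF.
apply: eq_card => A; rewrite inE; apply/eqP/imsetP => [<-|[B]].
  exists (A :\: C); last by rewrite setUC setID.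
  by rewrite inE; apply/subsetP => x; rewrite !inE => /andP[].
rewrite inE => sB ->; rewrite setIUl (setIidPl sFC).
suff -> : B :&: C = set0 by rewrite set0U.
apply/eqP; rewrite setI_eq0 -[C]setCK disjoints_subset setCK; exact: sB.
Qed.

(** * Permutations and the order of their values *)

Section Ranks.
Variable n : nat.

(** The values of p below p i are 0, ..., p i - 1, each taken once; this turns
    the order information into values. *)
Lemma perm_rank (p : 'S_n) i : #|[set j | p j < p i]| = p i.
Proof.
rewrite -(card_imset _ (@perm_inj _ p)).
rewrite -[RHS](subn0 (p i))
  -(@card_ord_interval n 0 (p i)) ?(ltnW (ltn_ord _)) //.
apply: eq_card => v; rewrite !inE /=; apply/imsetP/idP => [[j]|lt_v].
  by rewrite inE => lt_j ->.
by exists (p^-1 v)%g; rewrite ?inE permKV.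
Qed.

Lemma standardization (key : 'I_n -> nat) : injective key ->
  exists p : 'S_n, forall i j, (p i < p j) = (key i < key j).
Proof.
move=> key_inj.
pose below i := [set j | key j < key i].
have below_lt i j : key i < key j -> #|below i| < #|below j|.
  move=> lt_ij; apply: proper_card; apply/properP; split.
    by apply/subsetP=> x; rewrite !inE => lt_xi; apply: ltn_trans lt_ij.
  by exists i; rewrite !inE ?ltnn.
have below_bound i : #|below i| < n.
  rewrite -[X in _ < X]card_ord -cardsT; apply: proper_card.
  by apply/properP; split=> //; exists i; rewrite !inE ?ltnn.
pose f i := Ordinal (below_bound i).
have f_lt i j : (f i < f j) = (key i < key j).
  apply/idP/idP => [|/below_lt //]; rewrite ltnNge => nlt.
  rewrite ltnNge leq_eqVlt; apply: contra nlt.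
  move=> /orP[/eqP/key_inj->//|/below_lt].
  exact: ltnW.
have f_inj : injective f.
  move=> i j eq_f; apply: key_inj; apply/eqP; rewrite eqn_leq.
  by rewrite leqNgt -f_lt eq_f ltnn leqNgt -f_lt eq_f ltnn.
by exists (perm f_inj) => i j; rewrite !permE f_lt.
Qed.

Lemma perm_eq_of_order (p q : 'S_n) :
  (forall i j : 'I_n, i < j -> (p i < p j) = (q i < q j)) -> p = q.
Proof.
move=> eq_pq.
have eq_all i j : (p i < p j) = (q i < q j).
  case: (ltngtP i j) => [|lt_ji|/val_inj->]; [exact: eq_pq| |by rewrite !ltnn].
  have neq (r : 'S_n) : (r i < r j) = ~~ (r j < r i).
    rewrite -leqNgt [RHS]leq_eqVlt; case: eqP => //= /val_inj/perm_inj eq_ij.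
    by rewrite eq_ij ltnn in lt_ji.
  by rewrite !neq eq_pq.
apply/permP=> i; apply: val_inj; rewrite -[LHS]perm_rank -[RHS]perm_rank.
by apply: eq_card => j; rewrite !inE eq_all.
Qed.

End Ranks.

(** * Pattern avoidance in terms of values *)

Lemma contains3 (a : 'S_3) n (p : 'S_n) :
  contains a p <->
  exists i j k : 'I_n, i < j < k /\
    let v := nth 0 [:: val (p i); val (p j); val (p k)] in
    forall x y : 'I_3, (v x < v y) = (a x < a y).
Proof.
split=> [/existsP[f /andP[/forallP incf /forallP ordf]]|].
  exists (f (@Ordinal 3 0 isT)), (f (@Ordinal 3 1 isT)), (f (@Ordinal 3 2 isT)).
  have inc (x y : 'I_3) : x < y -> f x < f y.
    by move=> lt_xy; have /forallP/(_ y)/implyP := incf x; apply.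
  split; first by rewrite !inc.
  have nthE (x : 'I_3) : nth 0 [:: val (p (f (@Ordinal 3 0 isT)));
      val (p (f (@Ordinal 3 1 isT))); val (p (f (@Ordinal 3 2 isT)))] x
        = p (f x) :> nat.
    case: x => [[|[|[|x]]] hx] //=; by congr (val (p (f _))); apply: val_inj.
  move=> v x y; rewrite /v !nthE.
  by have /forallP/(_ y)/eqP := ordf x.
case=> i [j [k [/andP[ij jk] /= ordv]]].
pose f := [ffun x : 'I_3 => nth i [:: i; j; k] x].
have fE (x : 'I_3) : val (p (f x)) =
     nth 0 [:: val (p i); val (p j); val (p k)] x.
  by rewrite ffunE; case: x => [[|[|[|x]]] hx].
apply/existsP; exists f; apply/andP.
split; apply/forallP=> x; apply/forallP=> y.
  apply/implyP; rewrite !ffunE.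
  by case: x y => [[|[|[|x]]] hx] // [[|[|[|y]]] hy] //= _; apply: ltn_trans jk.
by apply/eqP; rewrite -ordv -!fE.
Qed.

Definition avoids_213_132 n (p : 'S_n) : Prop :=
  forall i j k : 'I_n, i < j < k ->
    ~~ (p j < p i < p k) /\ ~~ (p i < p k < p j).

Lemma p213E (x : 'I_3) : p213 x = nth 0 [:: 1; 0; 2] x :> nat.
Proof.
by case: x => [[|[|[|x]]] hx] //; rewrite permE /= -!val_eqE /= !inordK.
Qed.

Lemma p132E (x : 'I_3) : p132 x = nth 0 [:: 0; 2; 1] x :> nat.
Proof.
by case: x => [[|[|[|x]]] hx] //; rewrite permE /= -!val_eqE /= !inordK.
Qed.

Lemma avoidsP n (p : 'S_n) : avoids p T_213_132 <-> avoids_213_132 p.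
Proof.
pose o0 := @Ordinal 3 0 isT; pose o1 := @Ordinal 3 1 isT.
pose o2 := @Ordinal 3 2 isT.
split=> [/and3P[/negP no213 /negP no132 _] i j k ijk | no].
  split; apply/negP => /andP[lt1 lt2].
    apply/no213/contains3; exists i, j, k; split=> // v x y.
    rewrite !p213E /v.
    by case: x y => [[|[|[|x]]] hx] // [[|[|[|y]]] hy] //=; lia.
  apply/no132/contains3; exists i, j, k; split=> // v x y.
  rewrite !p132E /v.
  by case: x y => [[|[|[|x]]] hx] // [[|[|[|y]]] hy] //=; lia.
apply/and3P; split=> //; apply/negP => /contains3[i [j [k [ijk ord]]]];
  have [/negP no213 /negP no132] := no i j k ijk.
  by case: no213; have := (ord o1 o0, ord o0 o2); rewrite !p213E /= => -[-> ->].
by case: no132; have := (ord o0 o2, ord o2 o1); rewrite !p132E /= => -[-> ->].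
Qed.

(** * Descents *)

Section Descents.
Variable m : nat.
Implicit Types (p : 'S_m.+1).

(** Positions are natural numbers here, so that neighbours d and d + 1
    and bounds of blocks need no casts; only positions up to m are meaningful. *)
Definition value p (i : nat) : nat := p (inord i).

Definition descent p (d : nat) : bool := value p d.+1 < value p d.

Lemma value_ord p (i : 'I_m.+1) : value p i = p i.
Proof. by rewrite /value inord_val. Qed.

Lemma value_inj p i j : i <= m -> j <= m -> value p i = value p j -> i = j.
Proof. by move=> lei lej /val_inj/perm_inj/(congr1 val); rewrite /= !inordK. Qed.

Lemma avoids_value p : avoids_213_132 p -> forall i j k, i < j < k -> k <= m ->
  ~~ (value p j < value p i < value p k) /\
  ~~ (value p i < value p k < value p j).
Proof. by move=> av i j k ijk lek; apply: av; rewrite !inordK; lia. Qed.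

(** A descent at d between i and j with p i < p j would give an occurrence
    of 213 at i, d + 1, j if p (d + 1) < p i, and of 132 at i, d, d + 1
    otherwise. *)
Lemma avoider_ltP p i j : avoids_213_132 p -> i < j <= m ->
  (value p i < value p j) <-> (forall d, i <= d < j -> ~~ descent p d).
Proof.
move=> av /andP[lt_ij le_jm]; split=> [lt_p d /andP[le_id lt_dj] | no_desc].
  apply/negP; rewrite /descent => desc_d.
  have [lt1|le1] := ltnP (value p d.+1) (value p i).
    have d1j : d.+1 < j.
      rewrite ltn_neqAle lt_dj andbT; apply/eqP => d1j.
      by rewrite -d1j in lt_p; lia.
    have [] := avoids_value av (i := i) (j := d.+1) (k := j)
      ltac:(lia) ltac:(lia); lia.
  have ne1 : value p i != value p d.+1.
    by apply/eqP => /value_inj eq_i; have := eq_i ltac:(lia) ltac:(lia); lia.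
  have lt_id : i < d.
    rewrite ltn_neqAle le_id andbT; apply/eqP => eq_id.
    by move: le1 desc_d; rewrite eq_id; lia.
  have [] := avoids_value av (i := i) (j := d) (k := d.+1)
    ltac:(lia) ltac:(lia); lia.
elim: j lt_ij le_jm no_desc => // j IHj lt_ij le_jm no_desc.
have : ~~ descent p j by apply: no_desc; lia.
rewrite /descent -leqNgt leq_eqVlt => /orP[/eqP/value_inj eq_j|lt_j].
  by have := eq_j ltac:(lia) ltac:(lia); lia.
move: lt_ij; rewrite ltnS leq_eqVlt => /orP[/eqP-> //|lt_ij].
apply: leq_trans lt_j; apply: ltnW; apply: IHj; [done|lia|].
by move=> d d_in; apply: no_desc; lia.
Qed.

Definition descents p : {set 'I_m} := [set d : 'I_m | descent p d].

Lemma descents_inj p q : avoids_213_132 p -> avoids_213_132 q ->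
  descents p = descents q -> p = q.
Proof.
move=> avp avq eq_des; apply: perm_eq_of_order => i j lt_ij.
have le_jm : j <= m by rewrite -ltnS.
have same_desc d : i <= d < j -> descent p d = descent q d.
  move=> /andP[_ lt_dj]; have lt_dm : d < m by apply: leq_trans le_jm.
  by have /setP/(_ (Ordinal lt_dm)) := eq_des; rewrite !inE.
have ijm : i < j <= m by rewrite lt_ij.
rewrite -!(value_ord p) -!(value_ord q).
apply/idP/idP=> /(avoider_ltP _ ijm) no_desc; apply/avoider_ltP => // d d_in.
  by rewrite -same_desc //; apply: no_desc.
by rewrite same_desc //; apply: no_desc.
Qed.

(** Counting the elements of A still to come as the leading digit of a key in
    base m + 1 makes the key drop when an element of A is passed, and
    increase otherwise. *)
Lemma descents_surj (A : {set 'I_m}) :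
  exists2 p, avoids_213_132 p & descents p = A.
Proof.
pose later (i : nat) := #|[set d in A | i <= d]|.
have later_mono i j : i <= j -> later j <= later i.
  move=> le_ij; apply: subset_leq_card; apply/subsetP=> d; rewrite !inE.
  by case/andP=> -> /(leq_trans le_ij).
have later_succ (d : 'I_m) : later d = (d \in A) + later d.+1.
  rewrite /later (cardsD1 d) !inE leqnn andbT; congr (_ + _).
  apply: eq_card => x; rewrite !inE ltn_neqAle eq_sym.
  by case: (x \in A); rewrite ?andbF.
pose key (i : 'I_m.+1) := later i * m.+1 + i.
have key_lt (i j : 'I_m.+1) : i < j -> (key i < key j) = (later i == later j).
  move=> lt_ij; have := later_mono i j (ltnW lt_ij); have := ltn_ord j.
  by rewrite /key; nia.
have key_gt (i j : 'I_m.+1) : i < j -> (key j < key i) = (later i != later j).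
  move=> lt_ij; have := later_mono i j (ltnW lt_ij); have := ltn_ord j.
  by rewrite /key; nia.
have key_inj : injective key.
  move=> i j eq_key; have [lt_ij|lt_ji|/val_inj //] := ltngtP i j.
    by have := key_lt _ _ lt_ij; have := key_gt _ _ lt_ij; rewrite eq_key; lia.
  by have := key_lt _ _ lt_ji; have := key_gt _ _ lt_ji; rewrite eq_key; lia.
have [p ltpE] := standardization key_inj.
exists p => [i j k /andP[lt_ij lt_jk]|].
  have lt_ik := ltn_trans lt_ij lt_jk.
  have := later_mono i j (ltnW lt_ij); have := later_mono j k (ltnW lt_jk).
  rewrite !ltpE; have := key_lt _ _ lt_ij; have := key_gt _ _ lt_ij.
  have := key_lt _ _ lt_ik; have := key_gt _ _ lt_jk; lia.
apply/setP=> d; have := ltn_ord d => lt_dm.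
rewrite inE /descent /value ltpE key_gt !inordK //; try lia.
by rewrite later_succ; case: (d \in A); lia.
Qed.

(** * Blocks *)

(** A half-open interval [s, e) that is a maximal ascending run of p. *)
Definition block p s e : Prop :=
  [/\ s < e <= m.+1, s = 0 \/ descent p s.-1, e = m.+1 \/ descent p e.-1
    & forall d, s <= d < e.-1 -> ~~ descent p d].

Lemma block_exists p i : i <= m -> exists s e, block p s e /\ s <= i < e.
Proof.
move=> le_im.
have [s [le_si start_s no_s]] : exists s, [/\ s <= i, s = 0 \/ descent p s.-1
    & forall d, s <= d < i -> ~~ descent p d].
  elim: i {le_im} => [|i [s [le_si start_s no_s]]].
    by exists 0; split=> //; left.
  have [desc_i|no_i] := boolP (descent p i).
    by exists i.+1; split=> // [|d]; [right | lia].
  exists s; split=> // [|d d_in]; first by lia.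
  by have [->|ne_d] := eqVneq d i; [|apply: no_s; lia].
have [e [e_in end_e no_e]] : exists e, [/\ i < e <= m.+1,
    e = m.+1 \/ descent p e.-1 & forall d, i <= d < e.-1 -> ~~ descent p d].
  have [r] := ubnP (m - i).
  elim: r i le_im {le_si no_s} => // r IHr i le_im lt_r.
  have [->|ne_im] := eqVneq i m.
    by exists m.+1; split; [lia | left | lia].
  have [desc_i|no_i] := boolP (descent p i).
    by exists i.+1; split; [lia | right | lia].
  have [e [e_in end_e no_e]] := IHr i.+1 ltac:(lia) ltac:(lia).
  exists e; split=> // [|d d_in]; first by lia.
  by have [->|ne_d] := eqVneq d i; [|apply: no_e; lia].
exists s, e; split; last by lia.
split=> // [|d d_in]; first by lia.
by have [lt_di|le_id] := ltnP d i; [apply: no_s; lia | apply: no_e; lia].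
Qed.

Lemma value_before_block p s e i j : avoids_213_132 p -> block p s e ->
  i < s <= j -> j <= m -> value p j < value p i.
Proof.
move=> av [_ start_s _ _] ijs le_jm; rewrite ltnNge; apply/negP => le_v.
have lt_v : value p i < value p j.
  rewrite ltn_neqAle le_v andbT; apply/eqP => /value_inj; lia.
have := (avoider_ltP av (i := i) (j := j) ltac:(lia)).1 lt_v s.-1 ltac:(lia).
by case: start_s => [|->//]; lia.
Qed.

Lemma value_after_block p s e i j : avoids_213_132 p -> block p s e ->
  i < e <= j -> j <= m -> value p j < value p i.
Proof.
move=> av [_ _ end_e _] ije le_jm; rewrite ltnNge; apply/negP => le_v.
have lt_v : value p i < value p j.
  rewrite ltn_neqAle le_v andbT; apply/eqP => /value_inj; lia.
have := (avoider_ltP av (i := i) (j := j) ltac:(lia)).1 lt_v e.-1 ltac:(lia).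
by case: end_e => [|->//]; lia.
Qed.

(** The positions with a value below p i are those after the block and those
    before i inside it. *)
Lemma value_in_block p s e i : avoids_213_132 p -> block p s e ->
  s <= i < e -> value p i + s + e = m.+1 + i.
Proof.
move=> av blk i_in; have [se_in _ _ no_desc] := blk.
have le_im : i <= m by lia.
have inc j k : s <= j -> j < k < e -> value p j < value p k.
  move=> le_sj jk; apply/avoider_ltP => // [|d d_in]; first by lia.
  by apply: no_desc; lia.
have : value p i =
    #|[set j : 'I_m.+1 | s <= j < i] :|: [set j : 'I_m.+1 | e <= j < m.+1]|.
  rewrite {1}/value -perm_rank; apply: eq_card => j; rewrite !inE.
  have le_jm : j <= m by rewrite -ltnS.
  rewrite -value_ord -/(value p i).
  have [lt_js|le_sj] /= := ltnP j s.
    have := value_before_block av blk (i := j) (j := i) ltac:(lia) le_im; lia.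
  have [le_ej|lt_je] /= := leqP e j.
    have := value_after_block av blk (i := i) (j := j) ltac:(lia) le_jm; lia.
  have [lt_ij|lt_ji|->] := ltngtP i j; last by rewrite ltnn; lia.
    by have := inc i j ltac:(lia) ltac:(lia); lia.
  by have := inc j i ltac:(lia) ltac:(lia); lia.
rewrite cardsU !card_ord_interval //; last by lia.
rewrite (_ : _ :&: _ = set0) ?cards0; first by lia.
by apply/setP=> j; rewrite !inE; lia.
Qed.

(** * Fixed points *)

(** Outside the central block, positions to its left have values above p s = s
    and positions to its right have values below s, so none is fixed. *)
Lemma fixed_in_central_block p s e i : avoids_213_132 p -> block p s e ->
  s + e = m.+1 -> i <= m -> (value p i == i) = (s <= i < e).
Proof.
move=> av blk central le_im; have [se_in _ _ _] := blk.
have [i_in|i_out] := boolP (s <= i < e).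
  by have := value_in_block av blk i_in; lia.
have val_s := value_in_block av blk (i := s) ltac:(lia).
have [lt_is|le_si] := ltnP i s.
  by have := value_before_block av blk (i := i) (j := s)
    ltac:(lia) ltac:(lia); lia.
by have := value_after_block av blk (i := s) (j := i) ltac:(lia) le_im; lia.
Qed.

Lemma nb_fixed_central_block p s e : avoids_213_132 p -> block p s e ->
  s + e = m.+1 -> nb_fixed p = e - s.
Proof.
move=> av blk central; have [se_in _ _ _] := blk.
rewrite -(@card_ord_interval m.+1 s e); last by lia.
apply: eq_card => i; rewrite !inE -(fixed_in_central_block av blk) //.
  by rewrite value_ord.
by rewrite -ltnS.
Qed.

(** Any fixed point makes its own block central, so all fixed points share
    that block. *)
Lemma nb_fixedP p k : avoids_213_132 p ->
  nb_fixed p = k.+1 <-> exists2 s, block p s (s + k.+1) & s.*2 + k.+1 = m.+1.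
Proof.
move=> av; split=> [fix_k | [s blk eq_m]]; last first.
  by rewrite (nb_fixed_central_block av blk); lia.
have /card_gt0P[i] : 0 < nb_fixed p by rewrite fix_k.
rewrite inE => /eqP fix_i.
have [s [e [blk i_in]]] := block_exists p (i := i) ltac:(rewrite -ltnS; done).
have := value_in_block av blk i_in; rewrite value_ord fix_i => val_i.
have central : s + e = m.+1 by lia.
have := nb_fixed_central_block av blk central; rewrite fix_k => eq_k.
by exists s; [rewrite (_ : s + k.+1 = e) //; lia | lia].
Qed.

(** * Counting avoiders by fixed points *)

(** Transports counting from avoiders to subsets of 'I_m. *)
Lemma card_avoiders (Q : pred 'S_m.+1) (P : pred {set 'I_m}) :
  (forall p, avoids_213_132 p -> Q p = P (descents p)) ->
  #|[set p | Q p && avoids p T_213_132]| = #|[set A | P A]|.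
Proof.
move=> QP; rewrite -(card_in_imset (f := descents)); last first.
  move=> p q; rewrite !inE => /andP[_ /avoidsP avp] /andP[_ /avoidsP avq].
  exact: descents_inj.
apply: eq_card => A; rewrite inE; apply/imsetP/idP => [[p]|PA].
  by rewrite inE => /andP[Qp /avoidsP av] ->; rewrite -QP.
have [p av desA] := descents_surj A; exists p => //.
by rewrite inE QP // desA PA; apply/avoidsP.
Qed.

Lemma s_avoid_total :
  \sum_(k < m.+2) s_avoid m.+1 k T_213_132 = 2 ^ m.
Proof.
have := @card_avoiders predT predT (fun _ _ => erefl).
have -> : #|[set A : {set 'I_m} | predT A]| = 2 ^ m.
  rewrite -[m in RHS]card_ord -cardsT -card_powerset powersetT.
  by apply: eq_card => A; rewrite !inE.
move=> <-.
have fix_lt (p : 'S_m.+1) : nb_fixed p < m.+2.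
  by rewrite ltnS (leq_trans (max_card _)) ?card_ord.
rewrite -sum1_card.
rewrite (partition_big (fun p => Ordinal (fix_lt p)) xpredT) //=.
apply: eq_bigr => k _; rewrite /s_avoid -sum1_card.
by apply: eq_bigl => p; rewrite !inE -val_eqE andbC.
Qed.

(** The descents that the central block [s, s + k + 1) prescribes: positions
    d in its window must be descents exactly at the two boundaries. For s = 0
    the block is everything, and the window has no boundary in it. *)
Definition boundary_set s k : {set 'I_m} :=
  [set d : 'I_m | (0 < s) && ((d == s.-1 :> nat) || (d == s + k :> nat))].

Definition block_window s k : {set 'I_m} :=
  [set d : 'I_m | s.-1 <= d < minn (s + k.+1) m].

Lemma block_descents p s k : s.*2 + k = m ->
  block p s (s + k.+1) <->
    (descents p :&: block_window s k == boundary_set s k).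
Proof.
move=> eq_m; split=> [[_ start_s end_s no_desc] | /eqP/setP eq_des].
  apply/eqP/setP=> d; rewrite !inE.
  have lt_dm := ltn_ord d.
  have [s0|s_gt0] := posnP s => /=.
    by have := no_desc d; case: (descent p d) => //= h; have := h ltac:(lia).
  have [->|ne1] := eqVneq (d : nat) s.-1.
    by case: start_s => [|->]; lia.
  have [->|ne2] := eqVneq (d : nat) (s + k).
    by move: end_s; rewrite addnS /= => -[|->]; lia.
  have [in_d|out_d] := boolP (s <= d < s + k).
    by rewrite (negbTE (no_desc d _)) //; lia.
  by case: (descent p d) => /=; lia.
have des d (lt_dm : d < m) := eq_des (Ordinal lt_dm).
split; first by lia.
- have [->|s_gt0] := posnP s; [by left | right].
  have lt_d : s.-1 < m by lia.
  by have := des _ lt_d; rewrite !inE /=; lia.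
- have [s0|s_gt0] := posnP s; [by left; lia | right].
  have lt_d : (s + k.+1).-1 < m by lia.
  by have := des _ lt_d; rewrite !inE /=; lia.
move=> d d_in; have lt_d : d < m by lia.
by have := des _ lt_d; rewrite !inE /=; lia.
Qed.

Lemma s_avoid_fixed k : k <= m ->
  s_avoid m.+1 k.+1 T_213_132 =
    if odd (m - k) then 0 else if k == m then 1 else 4 ^ ((m - k)./2.-1).
Proof.
move=> le_km; have := odd_double_half (m - k); set s := (m - k)./2.
case: ifP => _ /= eq_s.
  rewrite -[RHS](@cards0 {set 'I_m}).
  rewrite -(_ : [set A | pred0 A] = set0); last first.
    by apply/setP=> A; rewrite !inE.
  apply: card_avoiders => p av /=; apply/eqP/(nb_fixedP _ av) => -[s' _]; lia.
have eq_m : s.*2 + k = m by lia.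
rewrite /s_avoid /S_avoid.
rewrite (@card_avoiders _
  (fun A => A :&: block_window s k == boundary_set s k)).
  rewrite card_sets_with_trace; last first.
    by apply/subsetP=> d; have := ltn_ord d; rewrite !inE; lia.
  rewrite card_ord card_ord_interval ?geq_minr //.
  case: eqP => [eq_k|ne_k].
    by rewrite (_ : m - _ = 0) //; lia.
  rewrite (_ : m - _ = 2 * s.-1) ?expnM //; lia.
move=> p av; apply/eqP/idP => [/(nb_fixedP _ av)[s' blk eq']|].
  by apply/block_descents => //; rewrite (_ : s = s') //; lia.
move/block_descents => blk; apply/(nb_fixedP _ av).
by exists s; [apply: blk | lia].
Qed.

End Descents.

(** The number of avoiders whose central block leaves r positions outside. *)
Definition fixed_count r :=
  if odd r then 0 else if r == 0 then 1 else 4 ^ (r./2.-1).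

Lemma s_avoid_fixed_count n k : 0 < k <= n ->
  s_avoid n k T_213_132 = fixed_count (n - k).
Proof.
case: k n => // k [//|m] le_km; rewrite s_avoid_fixed // /fixed_count subSS.
by case: ifP => // _; congr (if _ then _ else _); apply/eqP/eqP; lia.
Qed.

Lemma s_avoid_derangements n : 0 < n ->
  s_avoid n 0 T_213_132 + \sum_(r < n) fixed_count r = 2 ^ n.-1.
Proof.
case: n => // m _; rewrite /= -s_avoid_total big_ord_recl; congr (_ + _).
rewrite (reindex_inj rev_ord_inj) /=; apply: eq_bigr => k _.
by rewrite s_avoid_fixed_count //= /bump /= add1n; have := ltn_ord k; lia.
Qed.

Lemma fixed_count_even r : 0 < r -> fixed_count (2 * r) = 4 ^ r.-1.
Proof.
by rewrite /fixed_count mul2n odd_double double_eq0 doubleK; case: r.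
Qed.

Lemma fixed_count_odd r : fixed_count (2 * r + 1) = 0.
Proof. by rewrite /fixed_count mul2n addn1 /= odd_double. Qed.

(** The terms are 1, 0, then 4 ^ 0, 0, 4 ^ 1, 0, and so on. *)
Lemma sum_fixed_count n :
  3 * \sum_(r < 2 * n.+1) fixed_count r = 4 ^ n + 2.
Proof.
elim: n => [|n IHn]; first by rewrite !big_ord_recl big_ord0.
rewrite (_ : 2 * n.+2 = (2 * n.+1 + 1).+1); last by lia.
rewrite -(big_mkord xpredT fixed_count) big_nat_recr // fixed_count_odd addn1.
rewrite big_nat_recr // fixed_count_even // big_mkord expnS.
by move: IHn => /=; lia.
Qed.

Lemma sum_fixed_count_odd n : 0 < n ->
  3 * \sum_(r < 2 * n + 1) fixed_count r = 4 ^ n + 2.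
Proof.
case: n => // n _; rewrite addn1 -(big_mkord xpredT fixed_count).
rewrite big_nat_recr // fixed_count_even // big_mkord mulnDr.
by rewrite sum_fixed_count expnS /=; lia.
Qed.

Theorem theorem2p4 : forall n : nat, 1 <= n ->
  s_avoid n (n - 1) T_213_132 = 0 /\
  s_avoid n n T_213_132 = 1 /\
  ((s_avoid (2 * n) 0 T_213_132)%:R = (5 * 4 ^+ (n - 1)%N - 2) / 3 :> rat)%R /\
  ((s_avoid (2 * n + 1) 0 T_213_132)%:R = 2 * (4 ^+ n - 1) / 3 :> rat)%R /\
  (forall k : nat, 1 <= k <= n - 1 ->
     s_avoid (2 * n) (2 * k) T_213_132 = 4 ^ (n - k - 1) /\
     s_avoid (2 * n + 1) (2 * k) T_213_132 = 0 /\
     s_avoid (2 * n) (2 * k + 1) T_213_132 = 0 /\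
     s_avoid (2 * n + 1) (2 * k + 1) T_213_132 = 4 ^ (n - k - 1)).
Proof.
move=> n n_gt0; split; [|split; [|split; [|split]]].
- have [->|n_gt1] := eqVneq n 1.
    have := @s_avoid_derangements 1 isT; rewrite subnn.
    by rewrite big_ord_recl big_ord0 /fixed_count /=; lia.
  by rewrite s_avoid_fixed_count; [rewrite (_ : n - (n - 1) = 1) //; lia | lia].
- by rewrite s_avoid_fixed_count ?n_gt0 ?leqnn // subnn.
- case: n n_gt0 => // n _.
  have := @s_avoid_derangements (2 * n.+1) ltac:(lia).
  have := sum_fixed_count n.
  rewrite (_ : (2 * n.+1).-1 = (2 * n).+1); last by lia.
  rewrite expnS expnM (_ : 2 ^ 2 = 4) // subn1 /=.
  set x := s_avoid _ _ _; set y := \sum_(_ < _) _; move=> eq_y eq_x.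
  (* The identity is divided by 3 only in rat. *)
  have : 3 * x + 2 = 5 * 4 ^ n by lia.
  by move/(congr1 (fun z => z%:R : rat)%R); rewrite natrD !natrM natrX; lra.
- have := @s_avoid_derangements (2 * n + 1) ltac:(lia).
  have := sum_fixed_count_odd n_gt0.
  rewrite (_ : (2 * n + 1).-1 = 2 * n); last by lia.
  rewrite expnM (_ : 2 ^ 2 = 4) //.
  set x := s_avoid _ _ _; set y := \sum_(_ < _) _; move=> eq_y eq_x.
  have : 3 * x + 2 = 2 * 4 ^ n by lia.
  by move/(congr1 (fun z => z%:R : rat)%R); rewrite natrD !natrM natrX; lra.
move=> k k_in.
rewrite !s_avoid_fixed_count; try lia.
split; [|split; [|split]].
- by rewrite -mulnBr fixed_count_even ?subn1; lia.
- by rewrite (_ : _ - _ = 2 * (n - k) + 1) ?fixed_count_odd //; lia.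
- by rewrite (_ : _ - _ = 2 * (n - k - 1) + 1) ?fixed_count_odd //; lia.
by rewrite (_ : _ - _ = 2 * (n - k)) ?fixed_count_even ?subn1; lia.
Qed.
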